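(* Let $\mu$ be a nonzero real constant. On the 4-dimensional symplectic manifold $T^*S^2=\{(\mathbf{S},\mathbf{P})\in\mathbb{R}^3\times\mathbb{R}^3:\ \|\mathbf{S}\|=1,\ \mathbf{P}\cdot\mathbf{S}=0\}$ consider the Hamiltonian function $$ H_P(\mathbf{S},\mathbf{P})=\frac{\mu^2}{2}\,\|\mathbf{S}\times\mathbf{P}\|^2 . $$ Then the Hamiltonian system on $T^*S^2$ defined by $H_P$ is completely integrable.
   Context: $S^2\subset\mathbb{R}^3$ is the unit sphere, and $\cdot$, $\times$, $\|\cdot\|$ are the Euclidean inner product, cross product and norm of $\mathbb{R}^3$. Using the Euclidean metric, $T^*S^2$ is identified with $\{(\mathbf{S},\mathbf{P})\in\mathbb{R}^3\times\mathbb{R}^3:\|\mathbf{S}\|=1,\ \mathbf{P}\cdot\mathbf{S}=0\}$; under this identification the canonical symplectic form of $T^*S^2$ is the restriction of the canonical symplectic form of $T^*\mathbb{R}^3=\mathbb{R}^3\times\mathbb{R}^3$. Completely integrable is meant in the sense of Liouville: on a symplectic manifold of dimension $2n$, the system with Hamiltonian $H$ is completely integrable if there exist $n$ smooth functions $f_1,\dots,f_n$ with $\{f_i,f_j\}=0$ and $\{H,f_i\}=0$ for all $i,j$, whose differentials are linearly independent on a dense open subset. Here $n=2$. *)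

(* Defs.v *)
From HB Require Import structures.
From mathcomp Require Import all_boot all_order all_algebra.
From mathcomp Require Import all_classical all_reals all_analysis.

Set Implicit Arguments.
Unset Strict Implicit.
Unset Printing Implicit Defensive.

Import Order.TTheory GRing.Theory Num.Theory.
Import numFieldNormedType.Exports.

Local Open Scope classical_set_scope.
Local Open Scope ring_scope.

Section Smoothness.
Context {R : realType} {V W : normedModType R}.

(* On a finite-dimensional V and an open U, quantifying over all directions v
   is the same as quantifying over the partial derivatives. *)
Fixpoint Ck_on (k : nat) (U : set V) (f : V -> W) : Prop :=
  match k with
  | 0 => forall x, U x -> {for x, continuous f}
  | k'.+1 => (forall x, U x -> differentiable f x) /\
             (forall v : V, Ck_on k' U (fun x => 'D_v f x))
  end.

Definition smooth_on (U : set V) (f : V -> W) : Prop :=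
  forall k, Ck_on k U f.

End Smoothness.

(* Calculus on a submanifold M embedded in a finite-dimensional V.  A function
   on M is represented by a function on V of which only the values on M matter.
   The constant form omega on V stands for its restriction to M, which is
   understood to be symplectic. *)
Section Submanifold.
Context {R : realType} {V : normedModType R}.
Implicit Types (M : set V) (f g : V -> R^o) (p v X : V).

Definition local_extension M f p g : Prop :=
  exists U : set V,
    [/\ open U, U p, smooth_on U g & forall x, M x -> U x -> g x = f x].

Definition smooth_on_submanifold M f : Prop :=
  forall p, M p -> exists g, local_extension M f p g.

(* Tangent vectors are the velocities of smooth curves drawn on M. *)
Definition tangent M p v : Prop :=
  exists (I : set R^o) (gamma : R^o -> V),
    [/\ open I /\ I 0, smooth_on I gamma, forall t, I t -> M (gamma t),
        gamma 0 = p & 'D_1 gamma 0 = v].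

(* For v tangent to M at p, the value does not depend on the extension chosen
   by xget, since any two of them agree along the curves drawn on M. *)
Definition differential M f p v : R :=
  'd (xget (fun=> 0) [set g | local_extension M f p g]) p v.

Definition is_hamiltonian_vector M (omega : V -> V -> R) f p X : Prop :=
  tangent M p X /\
  forall v, tangent M p v -> omega X v = differential M f p v.

(* X exists and is unique when omega is nondegenerate on the tangent space. *)
Definition hamiltonian_vector M (omega : V -> V -> R) f p : V :=
  xget 0 [set X | is_hamiltonian_vector M omega f p X].

Definition poisson M (omega : V -> V -> R) f g p : R :=
  omega (hamiltonian_vector M omega f p) (hamiltonian_vector M omega g p).

Definition independent_differentials M n (f : 'I_n -> V -> R^o) p : Prop :=
  forall c : 'I_n -> R,
    (forall v, tangent M p v -> \sum_(i < n) c i * differential M (f i) p v = 0) ->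
    forall i, c i = 0.

Definition open_in M (U : set V) : Prop :=
  exists2 O : set V, open O & U = M `&` O.

Definition dense_in M (U : set V) : Prop := M `<=` closure U.

(* Liouville integrability of the Hamiltonian H on the symplectic manifold
   (M, omega), of dimension 2n. *)
Definition completely_integrable n M (omega : V -> V -> R) (H : V -> R^o) : Prop :=
  smooth_on_submanifold M H /\
  exists f : 'I_n -> V -> R^o,
    [/\ forall i, smooth_on_submanifold M (f i),
        forall i j p, M p -> poisson M omega (f i) (f j) p = 0,
        forall i p, M p -> poisson M omega H (f i) p = 0
      & exists U : set V, [/\ open_in M U, dense_in M U &
          forall p, U p -> independent_differentials M f p]].

End Submanifold.

Section CotangentSphere.
Context {R : realType}.
Implicit Types u v : 'rV[R]_3.

Definition dot u v : R := \sum_(i < 3) u 0 i * v 0 i.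

(* The norm `|u| of the library is the sup norm; it is only used through the
   topology it induces. *)
Definition enorm u : R := Num.sqrt (dot u u).

Definition cross u v : 'rV[R]_3 :=
  let x (w : 'rV[R]_3) (k : nat) : R := w 0 (inord k) in
  \row_(i < 3) [:: x u 1%N * x v 2%N - x u 2%N * x v 1%N;
                   x u 2%N * x v 0%N - x u 0%N * x v 2%N;
                   x u 0%N * x v 1%N - x u 1%N * x v 0%N]`_i.

Definition TS2 : set ('rV[R]_3 * 'rV[R]_3) :=
  [set q | enorm q.1 = 1 /\ dot q.2 q.1 = 0].

(* The form sum_i dS_i /\ dP_i. *)
Definition omega_can (X Y : 'rV[R]_3 * 'rV[R]_3) : R :=
  dot X.1 Y.2 - dot X.2 Y.1.

Definition H_P (mu : R) (q : 'rV[R]_3 * 'rV[R]_3) : R^o :=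
  mu ^+ 2 / 2 * enorm (cross q.1 q.2) ^+ 2.

End CotangentSphere.

(* Main.v *)
Require Import Defs.
From HB Require Import structures.
From mathcomp Require Import all_boot all_order all_algebra.
From mathcomp Require Import all_classical all_reals all_analysis.
From mathcomp Require Import ring.
Import Order.TTheory GRing.Theory Num.Theory.
Import numFieldNormedType.Exports.
Local Open Scope classical_set_scope.
Local Open Scope ring_scope.

(** The integrals are H_P itself and the angular momentum L = S_0 P_1 - S_1 P_0.
    On T*S^2 Lagrange's identity turns H_P into mu^2/2 |P|^2, which is invariant
    under the rotations about e_2; the generator of these rotations is the
    Hamiltonian vector field of L, whence {H_P, L} = 0.  Evaluating the
    differentials on the fibre vectors (0, S x P) and (0, P) gives (0, -P_2) and
    (mu^2 |P|^2, _), so they are independent wherever P_2 <> 0.  This set is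
    dense: where S <> +-e_2 one moves P in its fibre, and the points with
    S = +-e_2 are reached by moving along a great circle.

    All the curves needed have the form A + cos t B + sin t C, a family stable
    under differentiation. *)

(** [Ck_on] passes from a function to its directional derivatives, so a class of differentiable
    functions stable under every ['D_v] meets each level by induction on [k]. *)
Lemma smooth_on_derivation_closed {R : realType} {V W : normedModType R}
    (F : set (V -> W)) (U : set V) (f : V -> W) :
  (forall g, F g -> forall x, differentiable g x) ->
  (forall g v, F g -> F (fun x => 'D_v g x)) ->
  F f -> smooth_on U f.
Proof.
move=> Fdiff Fder Ff k; elim: k f Ff => [|k IHk] f Ff /=.
  by move=> x _; exact/differentiable_continuous/Fdiff.
by split=> [x _|v]; [exact: Fdiff | exact/IHk/Fder].
Qed.

(** * Trigonometric curves: smoothness, velocities and limit points *)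

Section TrigCurves.
Context {R : realType} {V : normedModType R}.

Definition trig_curve (A B C : V) (t : R^o) : V := A + cos t *: B + sin t *: C.

Lemma is_diff_trig_curve (A B C : V) (t : R^o) :
  is_diff t (trig_curve A B C) (fun v => (- (v * sin t)) *: B + (v * cos t) *: C).
Proof.
have dcos : differentiable (@cos R : R^o -> R^o) t by exact/derivable1_diffP.
have dsin : differentiable (@sin R : R^o -> R^o) t by exact/derivable1_diffP.
have dB : differentiable (fun s : R^o => cos s *: B) t.
  exact: differentiableZl.
have dC : differentiable (fun s : R^o => sin s *: C) t.
  exact: differentiableZl.
have dA : differentiable (cst A : R^o -> V) t by exact: differentiable_cst.
have -> : trig_curve A B C =
  (cst A + (fun s : R^o => cos s *: B)) + (fun s : R^o => sin s *: C) by [].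
have dAB := differentiableD dA dB.
apply: DiffDef; first exact: differentiableD.
rewrite !diffD //.
rewrite diff_cst !diffZl //.
apply/funext => v /=; rewrite [X in X + _ + _]/(0 : V) add0r !deriv1E //= !derive1E.
by rewrite !derive_val scalerN.
Qed.

Lemma differentiable_trig_curve (A B C : V) (t : R^o) :
  differentiable (trig_curve A B C) t.
Proof. by have [] := is_diff_trig_curve A B C t. Qed.

Lemma derive_trig_curve (A B C : V) (t v : R^o) :
  'D_v (trig_curve A B C) t = trig_curve 0 (v *: C) (- v *: B) t.
Proof.
rewrite deriveE; last exact: differentiable_trig_curve.
have [_ ->] := is_diff_trig_curve A B C t; rewrite /trig_curve.
by rewrite add0r !scalerA addrC; congr (_ *: _ + _ *: _); ring.
Qed.

Lemma smooth_on_trig_curve (U : set R^o) (A B C : V) :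
  smooth_on U (trig_curve A B C).
Proof.
apply: (@smooth_on_derivation_closed _ _ _
  [set f | exists A B C, f = trig_curve A B C]).
- by move=> g [A' [B' [C' ->]]] t; exact: differentiable_trig_curve.
- move=> g v [A' [B' [C' ->]]]; exists 0, (v *: C'), (- v *: B').
  by apply/funext => t; exact: derive_trig_curve.
- by exists A, B, C.
Qed.

(** At time 0 the curve passes through [A + B] with velocity [C]. All tangent vectors exhibited
    below are obtained in this way. *)
Lemma tangent_trig_curve (M : set V) (A B C : V) :
  (forall t, M (trig_curve A B C t)) -> tangent M (A + B) C.
Proof.
move=> MABC; exists setT, (trig_curve A B C); split => //.
- by split => //; exact: openT.
- exact: smooth_on_trig_curve.
- by rewrite /trig_curve cos0 sin0 scale1r scale0r addr0.
- by rewrite derive_trig_curve /trig_curve cos0 sin0 !scale1r scale0r add0r addr0.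
Qed.

(* The curve itself may leave [U] only at [t = 0]. *)
Lemma closure_trig_curve (U : set V) (A B C : V) :
  (forall t, 0 < t < pi -> U (trig_curve A B C t)) -> closure U (A + B).
Proof.
move=> HU N.
have -> : A + B = trig_curve A B C 0.
  by rewrite /trig_curve cos0 sin0 scale1r scale0r addr0.
move/(differentiable_continuous (differentiable_trig_curve A B C 0)) => /= N0.
suff UN : \forall t \near (0 : R)^'+, U (trig_curve A B C t) /\ N (trig_curve A B C t).
  by have [t UNt] := @filter_ex R _ (at_right_proper_filter 0) _ UN; exists (trig_curve A B C t).
near=> t; split; last by near: t; exact: cvg_within.
apply: HU; apply/andP; split; near: t; first exact: nbhs_right_gt.
exact/nbhs_right_lt/pi_gt0.
Unshelve. all: by end_near. Qed.

End TrigCurves.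

(** * Differentials and Hamiltonian vectors on a submanifold *)

Section Differential.
Context {R : realType} {V : normedModType R}.
Implicit Types (M : set V) (f g : V -> R^o) (p v : V).

Lemma smooth_on_differentiable (W W' : normedModType R) (U : set W) (h : W -> W') x :
  smooth_on U h -> U x -> differentiable h x.
Proof. by move=> /(_ 1%N)[hd _]; exact: hd. Qed.

(* By the chain rule along a curve on [M] with velocity [v], on which the two
   extensions agree. *)
Lemma local_extension_derive_eq M f g h p v :
  local_extension M f p g -> local_extension M f p h -> tangent M p v ->
  'D_v g p = 'D_v h p.
Proof.
move=> [Ug [oUg Ugp sg gf]] [Uh [oUh Uhp sh hf]].
move=> [I [c [[oI I0] sc cM c0 c1]]].
have dc : differentiable c 0 by exact: smooth_on_differentiable sc I0.
have dg : differentiable g p by exact: smooth_on_differentiable sg Ugp.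
have dh : differentiable h p by exact: smooth_on_differentiable sh Uhp.
have chain k : differentiable k p -> 'D_v k p = 'D_(1 : R^o) (k \o c) 0.
  move=> dk; rewrite -c0 in dk; rewrite [RHS]deriveE; last first.
    exact: differentiable_comp.
  by rewrite diff_comp //= -(deriveE _ dc) c1 -c0 deriveE.
rewrite !chain //; apply: near_eq_derive.
have near_c U : open U -> U p -> \forall t \near (0 : R^o), U (c t).
  move=> oU Up; apply: (differentiable_continuous dc); rewrite c0.
  exact: open_nbhs_nbhs.
near=> t => /=.
have Mt : M (c t) by apply: cM; near: t; exact: open_nbhs_nbhs.
by rewrite gf ?hf //; near: t; exact: near_c.
Unshelve. all: by end_near. Qed.

(** Since [g] is an extension, the function chosen by [xget] is one too, and two extensions have the
    same derivative along a tangent vector. *)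
Lemma differentialE M f g p v :
  local_extension M f p g -> tangent M p v -> differential M f p v = 'D_v g p.
Proof.
move=> fg Tv; rewrite /differential.
have ext : local_extension M f p (xget (fun=> 0) [set g | local_extension M f p g]).
  by apply: xgetPex; exists g.
rewrite -deriveE; first exact: (local_extension_derive_eq _ _ _ _ _ _ ext fg Tv).
by case: ext => [U [_ Up sg _]]; exact: smooth_on_differentiable sg Up.
Qed.

End Differential.

(** The default value 0 of [xget] is kept as a case: [omega_can] vanishes on it, so brackets can be
    computed by cases. *)
Lemma hamiltonian_vectorP {R : realType} {V : normedModType R} (M : set V)
    (omega : V -> V -> R) (f : V -> R^o) (p : V) :
  hamiltonian_vector M omega f p = 0 \/
  is_hamiltonian_vector M omega f p (hamiltonian_vector M omega f p).
Proof.
rewrite /hamiltonian_vector; case: xgetP => [X _ HX|_]; first by right.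
by left.
Qed.

(** * Polynomial functions and their smoothness *)

Section PolynomialFunctions.
Context {R : realType} {V : normedModType R}.

(** A class to feed to [smooth_on_derivation_closed]: by the Leibniz rule it is stable under ['D_v].
    A continuous linear form is encoded as a map that is its own differential at every point. *)
Inductive polynomial_fun : set (V -> R^o) :=
| polynomial_cst (a : R) : polynomial_fun (cst a)
| polynomial_linear (l : V -> R^o) : (forall p, is_diff p l l) -> polynomial_fun l
| polynomialD f g : polynomial_fun f -> polynomial_fun g -> polynomial_fun (f \+ g)
| polynomialM f g : polynomial_fun f -> polynomial_fun g -> polynomial_fun (f \* g).

Lemma differentiable_polynomial_fun f : polynomial_fun f ->
  forall p, differentiable f p.
Proof.
elim=> {f} [a p|l dl p|f g _ df _ dg p|f g _ df _ dg p].
- exact: differentiable_cst.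
- by have [] := dl p.
- exact: differentiableD.
- exact: differentiableM.
Qed.

Lemma derive_polynomial_fun f v : polynomial_fun f ->
  polynomial_fun (fun p => 'D_v f p).
Proof.
elim=> {f} [a|l dl|f g Pf Df Pg Dg|f g Pf Df Pg Dg].
- under eq_fun do rewrite derive_cst; exact: polynomial_cst.
- have D p : 'D_v l p = l v by have [dlp lp] := dl p; rewrite deriveE // lp.
  under eq_fun do rewrite D; exact: polynomial_cst.
- have -> : (fun p => 'D_v (f \+ g) p) = ('D_v f) \+ ('D_v g).
    apply/funext => p; apply: deriveD; exact/diff_derivable/differentiable_polynomial_fun.
  exact: polynomialD.
- have -> : (fun p => 'D_v (f \* g) p) = (f \* 'D_v g) \+ (g \* 'D_v f).
    apply/funext => p; apply: deriveM; exact/diff_derivable/differentiable_polynomial_fun.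
  by apply: polynomialD; exact: polynomialM.
Qed.

Lemma smooth_on_polynomial_fun (U : set V) f : polynomial_fun f -> smooth_on U f.
Proof.
move=> Pf; apply: (smooth_on_derivation_closed polynomial_fun); last exact: Pf.
- exact: differentiable_polynomial_fun.
- by move=> g v; exact: derive_polynomial_fun.
Qed.

Lemma local_extension_polynomial_fun (M : set V) (f g : V -> R^o) p :
  polynomial_fun g -> (forall q, M q -> g q = f q) -> local_extension M f p g.
Proof.
move=> Pg gf; exists setT; split => //.
- exact: openT.
- exact: smooth_on_polynomial_fun.
- by move=> q Mq _; exact: gf.
Qed.

End PolynomialFunctions.

(** * Coordinates on the phase space *)

Section Coordinates.
Context {R : realType}.
Local Notation phase := ('rV[R]_3 * 'rV[R]_3)%type.
Implicit Types (u w : 'rV[R]_3) (p q v : phase).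

Local Notation "u `# k" := (u 0 (inord k)) (at level 8, format "u `# k").

Lemma is_diff_coord (i : 'I_3) (u : 'rV[R]_3) :
  is_diff u (fun w : 'rV[R]_3 => w 0 i : R^o) (fun w => w 0 i).
Proof.
pose f (w : 'rV[R]_3) : R^o := w 0 i.
have lf : linear f by move=> a w w'; rewrite /f !mxE.
pose L := GRing.isLinear.Build R 'rV[R]_3 R^o _ f lf.
pose F : {linear 'rV[R]_3 -> R^o} := HB.pack f L.
have cF : continuous F by exact: coord_continuous.
apply: DiffDef; first exact: (linear_differentiable _ cF).
exact: (diff_lin _ cF).
Qed.

(** With [mom], these are the coordinates of S and P. Being linear, they also read off the
    components of tangent vectors. *)
Definition pos (k : nat) (q : phase) : R^o := q.1 0 (inord k).
Definition mom (k : nat) (q : phase) : R^o := q.2 0 (inord k).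

Lemma is_diff_pos k p : is_diff p (pos k) (pos k).
Proof.
have cfst : continuous (fst : phase -> 'rV[R]_3) by move=> q; exact: cvg_fst.
have dfst : is_diff p (fst : phase -> 'rV[R]_3) fst.
  by apply: DiffDef; [exact: linear_differentiable|exact: diff_lin].
exact: (is_diff_comp dfst (is_diff_coord (inord k) p.1)).
Qed.

Lemma is_diff_mom k p : is_diff p (mom k) (mom k).
Proof.
have csnd : continuous (snd : phase -> 'rV[R]_3) by move=> q; exact: cvg_snd.
have dsnd : is_diff p (snd : phase -> 'rV[R]_3) snd.
  by apply: DiffDef; [exact: linear_differentiable|exact: diff_lin].
exact: (is_diff_comp dsnd (is_diff_coord (inord k) p.2)).
Qed.

Lemma polynomial_pos k : polynomial_fun (pos k).
Proof. by apply: polynomial_linear => p; exact: is_diff_pos. Qed.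

Lemma polynomial_mom k : polynomial_fun (mom k).
Proof. by apply: polynomial_linear => p; exact: is_diff_mom. Qed.

Lemma is_derive_pos k p v : is_derive p v (pos k) (pos k v).
Proof.
have [d dE] := is_diff_pos k p.
by apply: DeriveDef; [exact: diff_derivable|rewrite deriveE ?dE].
Qed.

Lemma is_derive_mom k p v : is_derive p v (mom k) (mom k v).
Proof.
have [d dE] := is_diff_mom k p.
by apply: DeriveDef; [exact: diff_derivable|rewrite deriveE ?dE].
Qed.

Lemma dotE u w : dot u w = u`#0 * w`#0 + u`#1 * w`#1 + u`#2 * w`#2.
Proof.
rewrite /dot !big_ord_recr big_ord0 /= add0r.
by congr (u _ _ * w _ _ + u _ _ * w _ _ + u _ _ * w _ _); apply/val_inj;
  rewrite /= inordK.
Qed.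

Lemma enormE u : enorm u ^+ 2 = dot u u.
Proof. by rewrite sqr_sqrtr // dotE -!expr2 !addr_ge0 ?sqr_ge0. Qed.

Definition vec3 (a b c : R) : 'rV[R]_3 := \row_i [:: a; b; c]`_i.

Lemma vec3E a b c : ((vec3 a b c)`#0 = a) * ((vec3 a b c)`#1 = b) * ((vec3 a b c)`#2 = c).
Proof. by rewrite !mxE !inordK. Qed.

Lemma cross_vec3 u w : cross u w =
  vec3 (u`#1 * w`#2 - u`#2 * w`#1) (u`#2 * w`#0 - u`#0 * w`#2)
       (u`#0 * w`#1 - u`#1 * w`#0).
Proof. by []. Qed.

Lemma TS2E q : TS2 q <-> dot q.1 q.1 = 1 /\ dot q.2 q.1 = 0.
Proof.
have e1 : enorm q.1 = 1 <-> dot q.1 q.1 = 1.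
  rewrite -enormE; split=> [->|/eqP]; first by rewrite expr1n.
  by rewrite sqrp_eq1 ?sqrtr_ge0 // => /eqP.
by rewrite /TS2 /= e1.
Qed.

Lemma phase_eqP p q :
  (forall k, (k < 3)%N -> pos k p = pos k q /\ mom k p = mom k q) -> p = q.
Proof.
move=> pq; have ord3 (i : 'I_3) : i = inord i by rewrite inord_val.
case: p q pq => [p1 p2] [q1 q2] pq; congr (_, _); apply/rowP => i;
  by rewrite (ord3 i); case: (pq i (ltn_ord i)).
Qed.

Lemma pos0 k : pos k (0 : phase) = 0.
Proof. by rewrite /pos mxE. Qed.

Lemma mom0 k : mom k (0 : phase) = 0.
Proof. by rewrite /mom mxE. Qed.

Definition phase_point (s0 s1 s2 p0 p1 p2 : R) : phase := (vec3 s0 s1 s2, vec3 p0 p1 p2).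

Lemma phase_pointE (s0 s1 s2 p0 p1 p2 : R) : let q := phase_point s0 s1 s2 p0 p1 p2 in
  ((pos 0 q = s0) * (pos 1 q = s1) * (pos 2 q = s2)) *
  ((mom 0 q = p0) * (mom 1 q = p1) * (mom 2 q = p2)).
Proof. by rewrite /pos /mom /= !vec3E. Qed.

Lemma pos_trig_curve k p q v t :
  pos k (trig_curve p q v t) = pos k p + cos t * pos k q + sin t * pos k v.
Proof. by rewrite /pos /= !mxE. Qed.

Lemma mom_trig_curve k p q v t :
  mom k (trig_curve p q v t) = mom k p + cos t * mom k q + sin t * mom k v.
Proof. by rewrite /mom /= !mxE. Qed.

Lemma TS2_coordE q : TS2 q <->
  pos 0 q ^+ 2 + pos 1 q ^+ 2 + pos 2 q ^+ 2 = 1 /\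
  pos 0 q * mom 0 q + pos 1 q * mom 1 q + pos 2 q * mom 2 q = 0.
Proof.
rewrite TS2E !dotE -!expr2.
by rewrite ![q.2 _ _ * _]mulrC.
Qed.

Lemma omega_canE p q : omega_can p q =
  pos 0 p * mom 0 q + pos 1 p * mom 1 q + pos 2 p * mom 2 q -
  (mom 0 p * pos 0 q + mom 1 p * pos 1 q + mom 2 p * pos 2 q).
Proof. by rewrite /omega_can !dotE. Qed.

(** * The two integrals and their differentials *)

Definition kinetic_energy (mu : R) : phase -> R^o :=
  cst (mu ^+ 2 / 2) \* (mom 0 \* mom 0 \+ mom 1 \* mom 1 \+ mom 2 \* mom 2).

(** The difference is written with the constant -1 to match the constructors of [polynomial_fun]. *)
Definition angular_momentum : phase -> R^o :=
  pos 0 \* mom 1 \+ cst (-1) \* (pos 1 \* mom 0).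

Lemma polynomial_kinetic_energy mu : polynomial_fun (kinetic_energy mu).
Proof.
by do ![exact: polynomial_mom | apply: polynomialD | apply: polynomialM |
        exact: polynomial_cst].
Qed.

Lemma polynomial_angular_momentum : polynomial_fun angular_momentum.
Proof.
by do ![exact: polynomial_mom | exact: polynomial_pos | exact: polynomial_cst |
        apply: polynomialD | apply: polynomialM].
Qed.

Lemma H_P_TS2 mu q : TS2 q -> kinetic_energy mu q = H_P mu q.
Proof.
move=> /TS2_coordE[S1 SP0]; rewrite /H_P /kinetic_energy /= enormE dotE cross_vec3.
rewrite !vec3E -/(pos 0 q) -/(pos 1 q) -/(pos 2 q) -/(mom 0 q) -/(mom 1 q) -/(mom 2 q).
congr (_ * _); move: S1 SP0.
set a := pos 0 q; set b := pos 1 q; set c := pos 2 q.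
set x := mom 0 q; set y := mom 1 q; set z := mom 2 q => S1 SP0.
(* Lagrange's identity: |S x P|^2 = |S|^2 |P|^2 - (S.P)^2. *)
transitivity ((a ^+ 2 + b ^+ 2 + c ^+ 2) * (x * x + y * y + z * z)
              - (a * x + b * y + c * z) ^+ 2); last by ring.
by rewrite S1 SP0; ring.
Qed.

Lemma local_extension_H_P (mu : R) p :
  local_extension (@TS2 R) (H_P mu) p (kinetic_energy mu).
Proof.
apply: local_extension_polynomial_fun; first exact: polynomial_kinetic_energy.
exact: H_P_TS2.
Qed.

Lemma local_extension_angular_momentum p :
  local_extension (@TS2 R) angular_momentum p angular_momentum.
Proof. exact: (local_extension_polynomial_fun _ _ _ _ polynomial_angular_momentum). Qed.

Lemma differential_H_P (mu : R) p v : tangent (@TS2 R) p v ->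
  differential (@TS2 R) (H_P mu) p v =
  mu ^+ 2 * (mom 0 p * mom 0 v + mom 1 p * mom 1 v + mom 2 p * mom 2 v).
Proof.
move=> Tv; rewrite (differentialE _ _ _ _ _ (local_extension_H_P mu p) Tv).
have D0 := is_derive_mom 0 p v; have D1 := is_derive_mom 1 p v.
have D2 := is_derive_mom 2 p v.
rewrite /kinetic_energy; set s := _ \+ mom 2 \* mom 2.
have Ds : is_derive p v s (2 * (mom 0 p * mom 0 v + mom 1 p * mom 1 v + mom 2 p * mom 2 v)).
  have D := is_deriveD (is_deriveD (is_deriveM D0 D0) (is_deriveM D1 D1)) (is_deriveM D2 D2).
  by apply: (is_derive_eq D); rewrite /GRing.scale /=; ring.
have [_ ->] := is_deriveM (is_derive_cst (mu ^+ 2 / 2) p v) Ds.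
by rewrite /GRing.scale /=; field.
Qed.

Lemma differential_angular_momentum p v : tangent (@TS2 R) p v ->
  differential (@TS2 R) angular_momentum p v =
  pos 0 v * mom 1 p + pos 0 p * mom 1 v - (pos 1 v * mom 0 p + pos 1 p * mom 0 v).
Proof.
move=> Tv.
rewrite (differentialE _ _ _ _ _ (local_extension_angular_momentum p) Tv).
have P0 := is_derive_pos 0 p v; have P1 := is_derive_pos 1 p v.
have D0 := is_derive_mom 0 p v; have D1 := is_derive_mom 1 p v.
have [_ ->] := is_deriveD (is_deriveM P0 D1)
  (is_deriveM (is_derive_cst (-1 : R^o) p v) (is_deriveM P1 D0)).
by rewrite /GRing.scale /=; ring.
Qed.

(** * Rotations about [e_2], fibre vectors and the Poisson bracket *)

Definition rotation_field p : phase :=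
  phase_point (- pos 1 p) (pos 0 p) 0 (- mom 1 p) (mom 0 p) 0.

Lemma tangent_rotation_field p : TS2 p -> tangent (@TS2 R) p (rotation_field p).
Proof.
move=> /TS2_coordE[S1 SP0].
(* [A] is the part of S and P along the axis, fixed by the rotations, and [B] the horizontal part; a
   quarter turn carries [B] to [rotation_field p]. *)
pose A := phase_point 0 0 (pos 2 p) 0 0 (mom 2 p).
pose B := phase_point (pos 0 p) (pos 1 p) 0 (mom 0 p) (mom 1 p) 0.
have {1}-> : p = A + B.
  apply: phase_eqP => k; rewrite [pos k (A + B)]mxE [mom k (A + B)]mxE.
  by case: k => [|[|[|//]]] _; rewrite -!/(pos _ _) -!/(mom _ _) !phase_pointE ?add0r ?addr0.
apply: tangent_trig_curve => t; apply/TS2_coordE.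
rewrite !pos_trig_curve !mom_trig_curve !phase_pointE.
have := cos2Dsin2 t; move: (cos t) (sin t) => c s cs1.
split.
- rewrite -[RHS]S1 -[in RHS](mul1r (pos 0 p ^+ 2)) -[in RHS](mul1r (pos 1 p ^+ 2)) -cs1; ring.
- rewrite -[RHS]SP0 -[in RHS](mul1r (pos 0 p)) -[in RHS](mul1r (pos 1 p)) -cs1; ring.
Qed.

(** The segment in the fibre through [p] is run through as [p + sin t w], a trigonometric curve with
    [A = p] and [B = 0]. *)
Lemma tangent_fiber p (w0 w1 w2 : R) : TS2 p ->
  pos 0 p * w0 + pos 1 p * w1 + pos 2 p * w2 = 0 ->
  tangent (@TS2 R) p (phase_point 0 0 0 w0 w1 w2).
Proof.
move=> /TS2_coordE[S1 SP0] Sw0; rewrite -[p in tangent _ p]addr0.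
apply: tangent_trig_curve => t; apply/TS2_coordE.
rewrite !pos_trig_curve !mom_trig_curve !phase_pointE !pos0 !mom0 !mulr0 !addr0.
by split=> //; rewrite -[RHS]SP0 -[RHS]addr0 -(mulr0 (sin t)) -Sw0; ring.
Qed.

Lemma omega_can_alt p : omega_can p p = 0.
Proof. by rewrite omega_canE; ring. Qed.

Lemma omega_can_rotation_field p v : tangent (@TS2 R) p v ->
  omega_can (rotation_field p) v = differential (@TS2 R) angular_momentum p v.
Proof.
by move=> Tv; rewrite differential_angular_momentum // omega_canE !phase_pointE; ring.
Qed.

Lemma omega_can_antisym p q : omega_can p q = - omega_can q p.
Proof. by rewrite !omega_canE; ring. Qed.

Lemma omega_can0l q : omega_can 0 q = 0.
Proof. by rewrite /omega_can !dotE !mxE; ring. Qed.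

(** Let X, Y be the Hamiltonian vectors of [H_P] and L, and R the rotation field. As Y and R both
    represent dL on tangent vectors, omega(X, Y) = -dL(X) = omega(X, R) = dH_P(R), without
    identifying Y with R. The last term is a multiple of -P_0 P_1 + P_1 P_0 = 0. *)
Lemma poisson_H_P_angular_momentum (mu : R) p : TS2 p ->
  poisson (@TS2 R) omega_can (H_P mu) angular_momentum p = 0.
Proof.
move=> Mp; rewrite /poisson.
have [->|] := hamiltonian_vectorP (@TS2 R) omega_can (H_P mu) p.
  exact: omega_can0l.
move: (hamiltonian_vector _ _ (H_P mu) p) => X [TX HX].
have [->|] := hamiltonian_vectorP (@TS2 R) omega_can angular_momentum p.
  by rewrite omega_can_antisym omega_can0l oppr0.
move: (hamiltonian_vector _ _ _ p) => Y [TY HY].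
rewrite omega_can_antisym HY // -omega_can_rotation_field // -omega_can_antisym.
have TR := tangent_rotation_field _ Mp.
by rewrite HX // differential_H_P // !phase_pointE; ring.
Qed.

Lemma poisson_antisym f g p : poisson (@TS2 R) omega_can f g p =
  - poisson (@TS2 R) omega_can g f p.
Proof. exact: omega_can_antisym. Qed.

(** * The dense open set where P_2 is nonzero *)

Definition regular_set : set phase := @TS2 R `&` [set q | mom 2 q != 0].

Lemma open_in_regular_set : open_in (@TS2 R) regular_set.
Proof.
exists [set q | mom 2 q != 0] => //.
have cm : continuous (mom 2).
  by move=> q; apply/differentiable_continuous; have [] := is_diff_mom 2 q.
apply: (open_comp (f := mom 2) (D := [set x | x != 0])).
  by move=> q _; exact: cm.
exact: open_neq.
Qed.

Lemma closure_regular_set p : TS2 p -> pos 2 p ^+ 2 != 1 -> closure regular_set p.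
Proof.
move=> /[dup] Mp /TS2_coordE[S1 SP0] S2.
have [Pz|Pn] := eqVneq (mom 2 p) 0; last exact: subset_closure.
(* [C] is the fibre vector given by the projection of [e_2] on the tangent plane. *)
pose C := phase_point 0 0 0 (- pos 2 p * pos 0 p) (- pos 2 p * pos 1 p) (1 - pos 2 p ^+ 2).
rewrite -[p]addr0; apply: (closure_trig_curve _ p 0 C) => t t0pi.
split.
- apply/TS2_coordE.
  rewrite !pos_trig_curve !mom_trig_curve !phase_pointE !pos0 !mom0 !mulr0 !addr0.
  split=> //.
  transitivity (pos 0 p * mom 0 p + pos 1 p * mom 1 p + pos 2 p * mom 2 p
    + sin t * pos 2 p * (1 - (pos 0 p ^+ 2 + pos 1 p ^+ 2 + pos 2 p ^+ 2))); first by ring.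
  by rewrite SP0 S1 subrr mulr0 addr0.
(* As P_2 vanishes at [p], along the curve it equals sin t (1 - S_2^2), where S_2 is the constant
   value [pos 2 p]. *)
- rewrite /= mom_trig_curve phase_pointE mom0 Pz mulr0 !add0r mulf_neq0 //.
    by rewrite gt_eqF // sin_gt0_pi.
  by rewrite subr_eq0 eq_sym.
Qed.

Lemma dense_in_regular_set : dense_in (@TS2 R) regular_set.
Proof.
move=> p /[dup] Mp /TS2_coordE[S1 SP0].
have [S2|] := eqVneq (pos 2 p ^+ 2) 1; last exact: closure_regular_set.
have sqr01 : pos 0 p ^+ 2 + pos 1 p ^+ 2 = 0.
  by apply/(addIr (pos 2 p ^+ 2)); rewrite S1 add0r S2.
have /andP[/eqP p0 /eqP p1] : (pos 0 p == 0) && (pos 1 p == 0).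
  by rewrite -!(sqrf_eq0 (pos _ p)) -paddr_eq0 ?sqr_ge0 // sqr01.
have p2 : pos 2 p != 0 by rewrite -sqrf_eq0 S2 oner_eq0.
have P2 : mom 2 p = 0.
  by move: SP0; rewrite p0 p1 !mul0r !add0r => /eqP; rewrite mulf_eq0 (negPf p2) => /eqP.
(* A closure is closed, so it is enough to approach the pole through points of
   [closure regular_set], which the previous lemma provides. *)
rewrite ((closure_id _).1 (@closed_closure _ regular_set)).
(* The curve rotates S and P together about [e_0], hence stays on [TS2]: [A] is the fixed part, and
   [C] is [B] after a quarter turn. Along it S_2^2 = cos^2 t, which differs from 1 for 0 < t <
   pi. *)
pose A := phase_point 0 0 0 (mom 0 p) 0 0.
pose B := phase_point 0 0 (pos 2 p) 0 (mom 1 p) 0.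
pose C := phase_point 0 (- pos 2 p) 0 0 0 (mom 1 p).
have -> : p = A + B.
  apply: phase_eqP => k; rewrite [pos k (A + B)]mxE [mom k (A + B)]mxE.
  case: k => [|[|[|//]]] _; rewrite -!/(pos _ _) -!/(mom _ _) !phase_pointE ?add0r ?addr0 //.
apply: (closure_trig_curve _ A B C) => t t0pi.
apply: closure_regular_set.
  apply/TS2_coordE; rewrite !pos_trig_curve !mom_trig_curve !phase_pointE.
  split; last by ring.
  rewrite -[RHS](cos2Dsin2 t) -[in RHS](mulr1 (cos t ^+ 2)) -[in RHS](mulr1 (sin t ^+ 2)) -S2; ring.
rewrite pos_trig_curve !phase_pointE mulr0 add0r addr0 exprMn S2 mulr1.
by rewrite cos2sin2 subr_eq addrC -subr_eq subrr eq_sym sqrf_eq0 gt_eqF // sin_gt0_pi.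
Qed.

(** * Independence of the differentials and conclusion *)

Definition integrals (mu : R) (i : 'I_2) : phase -> R^o :=
  if i == 0 then H_P mu else angular_momentum.

Lemma independent_integrals (mu : R) p : mu != 0 -> regular_set p ->
  independent_differentials (@TS2 R) (integrals mu) p.
Proof.
move=> mu0 [/[dup] Mp /TS2_coordE[S1 SP0] /= P2] c cE.
(* The linear relation is tested on fibre vectors (0, w) only. *)
have {cE} dE (w0 w1 w2 : R) : pos 0 p * w0 + pos 1 p * w1 + pos 2 p * w2 = 0 ->
    c ord0 * (mu ^+ 2 * (mom 0 p * w0 + mom 1 p * w1 + mom 2 p * w2)) +
    c (lift ord0 ord0) * (pos 0 p * w1 - pos 1 p * w0) = 0.
  move=> Sw; have Tw := tangent_fiber _ _ _ _ Mp Sw.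
  have := cE _ Tw; rewrite !big_ord_recl big_ord0 addr0 /integrals /=.
  rewrite differential_H_P // differential_angular_momentum // !phase_pointE => <-; ring.
(* The fibre vector [S x P] kills the differential of [H_P]. *)
have c1 : c (lift ord0 ord0) = 0.
  pose w0 := pos 1 p * mom 2 p - pos 2 p * mom 1 p.
  pose w1 := pos 2 p * mom 0 p - pos 0 p * mom 2 p.
  pose w2 := pos 0 p * mom 1 p - pos 1 p * mom 0 p.
  have Sw : pos 0 p * w0 + pos 1 p * w1 + pos 2 p * w2 = 0.
    by rewrite /w0 /w1 /w2; ring.
  have Pw : mom 0 p * w0 + mom 1 p * w1 + mom 2 p * w2 = 0.
    by rewrite /w0 /w1 /w2; ring.
  have Lw : pos 0 p * w1 - pos 1 p * w0 = - mom 2 p.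
    (* Last component of S x (S x P) = S (S.P) - P |S|^2. *)
    transitivity (pos 2 p * (pos 0 p * mom 0 p + pos 1 p * mom 1 p + pos 2 p * mom 2 p)
      - mom 2 p * (pos 0 p ^+ 2 + pos 1 p ^+ 2 + pos 2 p ^+ 2)).
      by rewrite /w0 /w1; ring.
    by rewrite SP0 S1; ring.
  move: (dE _ _ _ Sw); rewrite Pw Lw !mulr0 add0r => /eqP.
  by rewrite mulf_eq0 oppr_eq0 (negPf P2) orbF => /eqP.
(* The fibre vector is now (0, P), tangent by [SP0]; on it dH_P takes the value mu^2 |P|^2, nonzero
   because P_2 is. *)
have c0 : c ord0 = 0.
  have E : mu ^+ 2 * (mom 0 p * mom 0 p + mom 1 p * mom 1 p + mom 2 p * mom 2 p) != 0.
    rewrite mulf_neq0 ?expf_neq0 // -!expr2 gt_eqF // ltr_wpDl ?addr_ge0 ?sqr_ge0 //.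
    by rewrite exprn_even_gt0.
  move: (dE _ _ _ SP0); rewrite c1 mul0r addr0 => /eqP.
  by rewrite mulf_eq0 (negPf E) orbF => /eqP.
by move=> i; case: (unliftP ord0 i) => [j ->|-> //]; rewrite ord1.
Qed.

End Coordinates.

Theorem mainTheorem2 (R : realType) (mu : R) (hmu : mu != 0) :
  completely_integrable 2 (@TS2 R) (@omega_can R) (H_P mu).
Proof.
have sH : smooth_on_submanifold (@TS2 R) (H_P mu).
  by move=> p _; exists (kinetic_energy mu); exact: local_extension_H_P.
have sL : smooth_on_submanifold (@TS2 R) angular_momentum.
  by move=> p _; exists angular_momentum; exact: local_extension_angular_momentum.
have HH p : poisson (@TS2 R) (@omega_can R) (H_P mu) (H_P mu) p = 0.
  exact: omega_can_alt.
split=> //; exists (integrals mu); split.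
- by move=> i; rewrite /integrals; case: ifP.
- move=> i j p Mp; rewrite /integrals; do 2![case: ifP => _] => //.
  + exact: poisson_H_P_angular_momentum.
  + by rewrite poisson_antisym poisson_H_P_angular_momentum ?oppr0.
  + exact: omega_can_alt.
- move=> i p Mp; rewrite /integrals; case: ifP => _ //.
  exact: poisson_H_P_angular_momentum.
- exists regular_set; split; [exact: open_in_regular_set|exact: dense_in_regular_set|].
  by move=> p; exact: independent_integrals.
Qed.
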